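(* Let $t\in\{\tfrac12,\tfrac13,\tfrac14\}$ and let $p>1$ be an integer. Let $P(x,y)$ be the irreducible polynomial (of equal degree in $x$ and $y$) such that $P(\alpha,\beta)=0$ for every solution $(\alpha,\beta)=(\pi_t(\tau),\pi_t(p\tau))$, $\tau\in\mathbb{H}$, of the generalized modular equation of order $p$ in the theory of signature $\tfrac1t$. If $(\alpha,\beta)$ is a solution satisfying $P(\alpha,\beta)=0$, then $(1-\beta,1-\alpha)$ is also a solution of the generalized modular equation and $P(1-\beta,1-\alpha)=0$.
   Context: For complex $a,b,c$ with $c\notin\{0,-1,-2,\dots\}$, ${}_2F_1(a,b;c;z)=\sum_{n\ge0}\frac{(a)_n(b)_n}{(c)_n n!}z^n$, extended analytically to $\mathbb{C}\setminus[1,\infty)$, with $(a)_0=1$, $(a)_n=a(a+1)\cdots(a+n-1)$. The generalized modular equation of order $p$ in the theory of signature $\tfrac1t$ is $$\frac{{}_2F_1(t,1-t;1;1-\beta)}{{}_2F_1(t,1-t;1;\beta)}=p\,\frac{{}_2F_1(t,1-t;1;1-\alpha)}{{}_2F_1(t,1-t;1;\alpha)},$$ i.e. $f_t(\beta)=p\,f_t(\alpha)$ where $f_t(z)=i\,{}_2F_1(t,1-t;1;1-z)/{}_2F_1(t,1-t;1;z)$. The map $f_t$ sends the upper half-plane $\mathbb{H}$ conformally onto a hyperbolic triangle; its inverse $\pi_t$, extended by repeated Schwarz reflection, is a single-valued function on $\mathbb{H}$ whose covering group is $H_e(\lambda_t)=\Big\{\begin{pmatrix}a&b\lambda_t\\c\lambda_t&d\end{pmatrix}: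 a,b,c,d\in\mathbb{Z},\ ad-bc\lambda_t^2=1\Big\}$ (modulo $\pm I$), with $\lambda_t=2\cos\frac{(1-2t)\pi}{2}$. Solutions of the modular equation are the pairs $(\alpha,\beta)=(\pi_t(\tau),\pi_t(p\tau))$ with $\tau\in\mathbb{H}$, valued in $H_e(\lambda_t)\backslash\mathbb{H}$ ($=\widehat{\mathbb{C}}\setminus\{0,1\}$ for $t=\tfrac13,\tfrac14$ and $\widehat{\mathbb{C}}\setminus\{0,1,\infty\}$ for $t=\tfrac12$). *)

(* Defs.v *)
From HB Require Import structures.
From mathcomp Require Import all_boot all_order all_algebra polyXY complex.
From mathcomp Require Import all_classical all_reals all_analysis.

Set Implicit Arguments.
Unset Strict Implicit.
Unset Printing Implicit Defensive.

Import Order.TTheory GRing.Theory Num.Theory.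
Import numFieldNormedType.Exports.

Local Open Scope classical_set_scope.
Local Open Scope ring_scope.

(* The complex numbers R[i] as a numClosedFieldType: topology and norm are
   inferred from this structure and not from the bare type. *)
Definition Cplx (R : realType) : numClosedFieldType := R[i].

Definition sphere (R : realType) := one_point_compactification (Cplx R).

Definition ofR (R : realType) (x : R) : Cplx R := (x%:C)%C.

Section Hypergeometric.
Variable R : realType.
Local Notation C := (Cplx R).

Definition pochhammer (a : C) (n : nat) : C := \prod_(k < n) (a + k%:R).

Definition hyp2F1_term (a b c z : C) (n : nat) : C :=
  pochhammer a n * pochhammer b n / (pochhammer c n * n`!%:R) * z ^+ n.

Definition slit_plane : set C := [set z | ~ ('Im z = 0 /\ 1 <= 'Re z)].

Definition analytic_at (F : C -> C) (z : C) : Prop :=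
  exists (u : nat -> C) (r : C), 0 < r /\
    forall w : C, `|w - z| < r ->
      series (fun n => u n * (w - z) ^+ n) @ \oo --> F w.

Definition is_hyp2F1 (a b c : C) (F : C -> C) : Prop :=
  (forall z, slit_plane z -> analytic_at F z) /\
  (forall z, `|z| < 1 -> series (hyp2F1_term a b c z) @ \oo --> F z).

(* The analytic continuation to the slit plane exists (when c is not a
   nonpositive integer) and is unique there; only its values on the slit plane
   are meaningful. *)
Definition hyp2F1 (a b c : C) : C -> C :=
  match pselect (exists F, is_hyp2F1 a b c F) with
  | left exF => projT1 (cid exF)
  | right _ => fun=> 0
  end.

End Hypergeometric.

Section ModularEquation.
Variable R : realType.
Local Notation C := (Cplx R).

Definition f_t (t : R) (z : C) : C :=
  'i * hyp2F1 (ofR t) (1 - ofR t) 1 (1 - z)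
     / hyp2F1 (ofR t) (1 - ofR t) 1 z.

Definition lambda_t (t : R) : C := ofR (2 * cos ((1 - 2 * t) * pi / 2)).

(* Hyperbolic reflections in the geodesics Re tau = c and |tau - c| = r, for c
   and r real. *)
Definition refl_line (c : C) (tau : C) : C := c *+ 2 - tau^*.
Definition refl_circle (c r : C) (tau : C) : C := c + r ^+ 2 / (tau^* - c).

Definition sphere_conj : sphere R -> sphere R := omap (fun z : C => z^*).
Definition sphere_1sub : sphere R -> sphere R := omap (fun z : C => 1 - z).

(* pi_rel t tau w: a chain of Schwarz reflections gives the inverse of f_t the
   value w at tau.  The first constructor is the inverse on the open triangle
   f_t(H), the second one is its continuous extension to the boundary points of
   that triangle lying in H (w is then real or infinite).  The sides of the
   triangle are the boundary values of f_t on (0,1), (-oo,0) and (1,+oo), which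
   lie on Re tau = 0, Re tau = lambda_t / 2 and
   |tau - 1 / lambda_t| = 1 / lambda_t.  Every triangle of the tessellation is
   the image of the first one under a word in the reflections in these three
   sides, and each reflection acts as complex conjugation on the values. *)
Inductive pi_rel (t : R) : C -> sphere R -> Prop :=
| pi_rel_inv (z : C) :
    0 < 'Im z -> pi_rel t (f_t t z) (Some z)
| pi_rel_boundary (z : nat -> C) (tau : C) (w : sphere R) :
    (forall n, 0 < 'Im (z n)) ->
    (fun n => Some (z n) : sphere R) @ \oo --> w ->
    (fun n => f_t t (z n)) @ \oo --> tau ->
    0 < 'Im tau ->
    pi_rel t tau w
| pi_rel_side01 (tau : C) (w : sphere R) :
    pi_rel t tau w -> pi_rel t (refl_line 0 tau) (sphere_conj w)
| pi_rel_side0 (tau : C) (w : sphere R) :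
    pi_rel t tau w ->
    pi_rel t (refl_line (lambda_t t / 2) tau) (sphere_conj w)
| pi_rel_side1 (tau : C) (w : sphere R) :
    pi_rel t tau w ->
    pi_rel t (refl_circle (lambda_t t)^-1 (lambda_t t)^-1 tau) (sphere_conj w).

(* For t = 1/2, 1/3, 1/4 the relation pi_rel is single-valued and total on the
   upper half-plane, so the default None (= infinity) is not used there. *)
Definition pi_t (t : R) (tau : C) : sphere R :=
  match pselect (exists! w, pi_rel t tau w) with
  | left exw => projT1 (cid exw)
  | right _ => None
  end.

Definition modular_solution (t : R) (p : nat) (alpha beta : sphere R) : Prop :=
  exists tau : C, [/\ 0 < 'Im tau, alpha = pi_t t tau
                    & beta = pi_t t (p%:R * tau)].

End ModularEquation.

Definition irreducible_elt (A : idomainType) (P : A) : Prop :=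
  [/\ P != 0, P \isn't a GRing.unit
    & forall Q S : A, P = Q * S -> Q \is a GRing.unit \/ S \is a GRing.unit].

Section SphereEvaluation.
Variable R : realType.
Local Notation C := (Cplx R).

(* Homogeneous coordinates: z = (z : 1) and infinity = (1 : 0). *)
Definition hnum (w : sphere R) : C := if w is Some z then z else 1.
Definition hden (w : sphere R) : C := if w is Some _ then 1 else 0.

(* P(x, y), with x the outer variable of {poly {poly C}} and y the inner one,
   homogenized separately in x and in y and evaluated on the product of two
   spheres. *)
Definition sphere_eval (P : {poly {poly C}}) (x y : sphere R) : C :=
  \sum_(i < size P) \sum_(j < sizeY P)
     P`_i`_j * (hnum x ^+ i * hden x ^+ ((size P).-1 - i))
             * (hnum y ^+ j * hden y ^+ ((sizeY P).-1 - j)).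

Lemma sphere_eval_fin (P : {poly {poly C}}) (x y : C) :
  sphere_eval P (Some x) (Some y) = P.[x, y].
Proof.
rewrite /sphere_eval (horner_coef P) horner_sum; apply: eq_bigr => i _ /=.
rewrite -polyC_exp hornerM hornerC.
rewrite (horner_coef_wide _ (max_size_coefXY P i)) mulr_suml; apply: eq_bigr => j _.
by rewrite !expr1n !mulr1 mulrAC.
Qed.

End SphereEvaluation.

(* Main.v *)
(* Write tau' = -1/(p tau).  Everything reduces to pi_t (-1/tau) = 1 - pi_t tau,
   since then pi_t tau' = 1 - pi_t (p tau) and pi_t (p tau') = 1 - pi_t tau.
   The relation pi_rel is invariant under (tau, w) |-> (-1/tau, 1 - w):
   on the first triangle f_t (1 - z) = -1 / f_t z, where z |-> 1 - z leaves the
   upper half-plane, so one uses z |-> 1 - conj z followed by the reflection in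
   Re tau = 0; and tau |-> -1/tau commutes with that reflection while it
   conjugates the reflections in the other two sides into each other, up to the
   first one.  Neither existence nor uniqueness of the value of pi_t is needed,
   both being transported by this symmetry.  The base case requires that the
   hypergeometric function with real parameters commutes with conjugation; this
   is uniqueness of analytic continuation on the slit plane, which is
   star-shaped at 0. *)
Require Import Defs.
From HB Require Import structures.
From mathcomp Require Import all_boot all_order all_algebra polyXY complex.
From mathcomp Require Import all_classical all_reals all_analysis.
From mathcomp Require Import ring lra.

Set Implicit Arguments.
Unset Strict Implicit.
Unset Printing Implicit Defensive.

Import Order.TTheory GRing.Theory Num.Theory.
Import numFieldNormedType.Exports.

Local Open Scope classical_set_scope.
Local Open Scope ring_scope.

(** * Isolated zeros of power series *)

Section PowerSeries.
Variable K : numFieldType.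
Implicit Types (v : nat -> K) (w : K).

(** The order of a [numFieldType] is only partial, but positive elements are real and hence
    comparable. *)
Lemma exists_min_gt0 (d e : K) : 0 < d -> 0 < e ->
  exists m, [/\ 0 < m, m <= d & m <= e].
Proof.
move=> d0 e0; have /orP[de|ed] := real_leVge (gtr0_real d0) (gtr0_real e0).
- by exists d.
- by exists e.
Qed.

Definition powser v w : nat -> K := series (fun n => v n * w ^+ n).

Lemma powserS v w n :
  powser v w n.+1 = v 0%N + w * powser (fun k => v k.+1) w n.
Proof.
rewrite /powser /series /= big_nat_recl //= expr0 mulr1 mulr_sumr.
by congr (_ + _); apply: eq_bigr => k _; rewrite exprS mulrCA.
Qed.

Lemma cvg_powserB u v w (a b : K) :
  powser u w @ \oo --> a -> powser v w @ \oo --> b ->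
  powser (fun n => u n - v n) w @ \oo --> a - b.
Proof.
move=> ua vb; have -> : powser (fun n => u n - v n) w = powser u w - powser v w.
  apply/funext => n; rewrite fctE /powser /series /= -sumrB.
  by apply: eq_bigr => k _; rewrite mulrBl.
exact: cvgB.
Qed.

Lemma geometric_sum_le2 (x : K) n : 0 <= x -> x <= 2^-1 ->
  \sum_(0 <= k < n) x ^+ k <= 2.
Proof.
move=> x0 x2; elim: n => [|n IHn]; first by rewrite big_nil.
rewrite big_nat_recl //= expr0; under eq_bigr => k _ do rewrite exprS.
rewrite -mulr_sumr -[leRHS]/(1 + 1) lerD2l.
apply: le_trans (ler_pM x0 _ x2 IHn) _.
  by apply: sumr_ge0 => k _; exact: exprn_ge0.
by rewrite mulVf ?pnatr_eq0.
Qed.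

(** The terms at [w] are at most [M] times the powers of [|w| / rho <= 1/2], so a geometric series
    dominates all partial sums uniformly. *)
Lemma powser_le v w (M rho : K) n : 0 < rho ->
  (forall k, `|v k| * rho ^+ k <= M) -> `|w| <= rho / 2 ->
  `|powser v w n| <= M * 2.
Proof.
move=> rho0 vM wrho; apply: le_trans (ler_norm_sum _ _ _) _.
have M0 : 0 <= M.
  by apply: le_trans (vM 0%N); apply: mulr_ge0 => //; apply/exprn_ge0/ltW.
have x0 : 0 <= `|w| / rho by apply: divr_ge0 => //; exact: ltW.
have x2 : `|w| / rho <= 2^-1 by rewrite ler_pdivrMr // mulrC.
apply: le_trans (ler_wpM2l M0 (geometric_sum_le2 n x0 x2)).
rewrite mulr_sumr; apply: ler_sum => k _.
have -> : `|v k * w ^+ k| = `|v k| * rho ^+ k * (`|w| / rho) ^+ k.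
  rewrite normrM normrX expr_div_n -mulrA; congr (_ * _).
  by rewrite mulrCA divff ?mulr1 // expf_neq0 // gt_eqF.
by apply: ler_wpM2r => //; exact: exprn_ge0.
Qed.

(** The series is [v 0] plus [w] times a shifted series that stays bounded near 0. If [v 0] were
    nonzero, it would dominate for small [w], and no zero could be that close to 0. *)
Lemma powser_coef0_eq0 v (M rho : K) : 0 < rho ->
  (forall k, `|v k| * rho ^+ k <= M) ->
  (forall e, 0 < e ->
    exists w, [/\ w != 0, `|w| < e & powser v w @ \oo --> 0]) ->
  v 0%N = 0.
Proof.
move=> rho0 vM zeros; apply/eqP/negPn/negP => v0.
have v0gt : 0 < `|v 0%N| by rewrite normr_gt0.
have v0M : `|v 0%N| <= M by have := vM 0%N; rewrite expr0 mulr1.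
have M0 : 0 < M by apply: lt_le_trans v0M.
have vM1 k : `|v k.+1| * rho ^+ k <= M / rho.
  by rewrite ler_pdivlMr // -mulrA -exprSr.
(* Chosen so that [|w|] times [2 * M / rho], the bound on the shifted series, is below
   [|v 0| / 2]. *)
have e0 : 0 < rho * `|v 0%N| / (M * 4) by rewrite divr_gt0 ?mulr_gt0.
have [w [_ wlt]] := zeros _ e0.
have v2 : 0 < `|v 0%N| / 2 by rewrite divr_gt0.
(* The partial sum is taken at [N.+1] rather than [N] so that [powserS] can split off [v 0]. *)
move=> /cvgrPdist_lt /(_ _ v2) [N _ /(_ N.+1 (leqnSn N))] /=.
rewrite sub0r normrN powserS => lt1.
have wrho : `|w| <= rho / 2.
  apply: le_trans (ltW wlt) _; rewrite ler_pdivrMr ?mulr_gt0 //.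
  rewrite -mulrA ler_wpM2l ?(ltW rho0) //; apply: le_trans v0M _.
  have -> : 2^-1 * (M * 4) = M + M by field.
  by rewrite lerDl ltW.
have lt2 : `|w * powser (fun k => v k.+1) w N| < `|v 0%N| / 2.
  rewrite normrM.
  apply: le_lt_trans (ler_wpM2l (normr_ge0 w) (powser_le N rho0 vM1 wrho)) _.
  have Mr : 0 < M / rho * 2 by rewrite mulr_gt0 ?divr_gt0.
  apply: lt_le_trans (_ : rho * `|v 0%N| / (M * 4) * (M / rho * 2) <= _).
    by rewrite ltr_pM2r.
  have -> : rho * `|v 0%N| / (M * 4) * (M / rho * 2) = `|v 0%N| / 2.
    by field; rewrite !gt_eqF.
  exact: lexx.
have := ltrD lt1 lt2; rewrite -splitr -[X in _ + X]normrN.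
move=> /(le_lt_trans (ler_normD _ _)).
by rewrite addrK ltxx.
Qed.

(** Once [v 0 = 0], dividing by [w != 0] gives the shifted series, with the same zeros and the bound
    [M / rho]; the induction therefore generalizes over [v] and [M]. *)
Lemma powser_eq0 v (M rho : K) : 0 < rho ->
  (forall k, `|v k| * rho ^+ k <= M) ->
  (forall e, 0 < e ->
    exists w, [/\ w != 0, `|w| < e & powser v w @ \oo --> 0]) ->
  forall n, v n = 0.
Proof.
move=> rho0 vM zeros n; elim: n => [|n IHn] in v M vM zeros *.
  exact: powser_coef0_eq0 vM zeros.
have v0 := powser_coef0_eq0 rho0 vM zeros.
apply: (IHn (fun k => v k.+1) (M / rho)) => [k|e e0].
  by rewrite ler_pdivlMr // -mulrA -exprSr.
have [w [w0 we cvw]] := zeros _ e0; exists w; split => //.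
rewrite -(mulr0 w^-1).
have -> : powser (fun k => v k.+1) w = (fun n => w^-1 * powser v w n.+1).
  by apply/funext => k; rewrite powserS v0 add0r mulKf.
by apply: cvgM; [exact: cvg_cst | rewrite cvg_shiftS].
Qed.

Lemma powser_terms_bounded v w : cvgn (powser v w) ->
  exists M, forall k, `|v k| * `|w| ^+ k <= M.
Proof.
move=> /cvg_series_cvg_0 cv0.
have : cvgn (fun k => v k * w ^+ k) by apply/cvg_ex; exists 0.
move=> /cvg_seq_bounded /pinfty_ex_gt0 [M _ vM]; exists M => k.
by rewrite -normrX -normrM; apply: vM.
Qed.

(** Convergence at [r / 2] bounds the terms there, which is the growth hypothesis of
    [powser_eq0]. *)
Lemma powser_isolated_zero v (D : K -> K) r : 0 < r ->
  (forall w, `|w| < r -> powser v w @ \oo --> D w) ->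
  (forall e, 0 < e -> exists w, [/\ w != 0, `|w| < e & D w = 0]) ->
  forall w, `|w| < r -> D w = 0.
Proof.
move=> r0 cvD zeros w wr.
have r2 : 0 < r / 2 by rewrite divr_gt0.
have nr2 : `|r / 2| = r / 2 by rewrite gtr0_norm.
have r2r : r / 2 < r by rewrite ltr_pdivrMr // ltr_pMr // ltr1n.
have [M vM] : exists M, forall k, `|v k| * `|r / 2| ^+ k <= M.
  by apply: powser_terms_bounded; apply/cvg_ex; exists (D (r / 2)); apply: cvD;
    rewrite nr2.
have v0 : forall n, v n = 0.
  apply: (@powser_eq0 _ M `|r / 2|) => //; first by rewrite nr2.
  move=> e e0; have [m [m0 me mr]] := exists_min_gt0 e0 r0.
  have [z [z0 zm Dz]] := zeros _ m0; exists z; split => //.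
    exact: lt_le_trans me.
  by rewrite -Dz; apply: cvD; exact: lt_le_trans mr.
have /cvg_unique := cvD _ wr; apply => //.
have -> : powser v w = fun=> 0; last exact: cvg_cst.
apply/funext => n; rewrite /powser /series /= big1 // => k _.
by rewrite v0 mul0r.
Qed.
End PowerSeries.

(** At infinity, neighbourhoods are complements of closed compact sets. The preimage of such a set
    under [f] is its image under [g], hence again closed and compact. *)
Lemma continuous_omap_homeomorphism (X Y : topologicalType)
    (f : X -> Y) (g : Y -> X) :
  cancel f g -> cancel g f -> continuous f -> continuous g ->
  continuous
    (omap f : one_point_compactification X -> one_point_compactification Y).
Proof.
move=> fK gK fc gc [x|] A /=.
  move=> /= nA; exact: (fc x _ nA).
move=> [U [Uc Ucl] UA]; exists (g @` U).
  split; first by apply: continuous_compact Uc; exact: continuous_subspaceT.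
  suff -> : g @` U = f @^-1` U by apply: closed_comp Ucl => y _; exact: fc.
  apply/seteqP; split => [_ [y Uy <-] /=|y /= Uy]; first by rewrite gK.
  by exists (f y).
move=> [x|] /= xU; apply: UA; last by right.
case: xU => // -[y gU [<-]]; left; exists (f y) => // fyU.
by apply: gU; exists (f y).
Qed.

(** * Real numbers inside the complex numbers *)

Section RealEmbedding.
Variable R : realType.
Local Notation C := (Cplx R).
Implicit Types x y : R.

Lemma ofRB x y : ofR (x - y) = ofR x - ofR y.
Proof. exact: (rmorphB (real_complex R)). Qed.

Lemma ofRM x y : ofR (x * y) = ofR x * ofR y.
Proof. exact: (rmorphM (real_complex R)). Qed.

Lemma ofR0 : ofR 0 = 0 :> C. Proof. by []. Qed.
Lemma ofR1 : ofR 1 = 1 :> C. Proof. by []. Qed.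

Lemma ofR_le x y : (ofR x <= ofR y) = (x <= y).
Proof. exact: lecR. Qed.

Lemma ofR_lt x y : (ofR x < ofR y) = (x < y).
Proof. exact: ltcR. Qed.

Lemma ofR_real x : ofR x \is Num.real.
Proof. by apply/complex_realP; exists x. Qed.

Lemma conj_ofR x : (ofR x)^* = ofR x.
Proof. exact: conj_Creal (ofR_real x). Qed.

Lemma norm_ofR x : `|ofR x| = ofR `|x|.
Proof. by rewrite /ofR normc_def /= expr0n /= addr0 sqrtr_sqr. Qed.

Lemma gt0_ofR (e : C) : 0 < e -> exists2 d, 0 < d & e = ofR d.
Proof.
move=> e0; have /complex_realP [d ed] := gtr0_real e0.
by exists d; rewrite // -ofR_lt /ofR -ed.
Qed.

End RealEmbedding.

(** * Analytic functions and the identity theorem along a segment *)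

Section Analytic.
Variable R : realType.
Local Notation C := (Cplx R).
Implicit Types (F G : C -> C) (z w : C).

Lemma near_dist_lt z e : 0 < e -> \forall w \near z, `|z - w| < e.
Proof. by move=> e0; have := nbhsx_ballx z e e0; rewrite -ball_normE. Qed.

Lemma continuous_conj : continuous (fun z : C => z^*).
Proof.
move=> z; apply/(@cvgrPdist_lt _ _ _ (nbhs z) (nbhs_filter z)) => e e0.
apply: filterS (near_dist_lt z e0) => w.
by rewrite -rmorphB norm_conjC.
Qed.

Lemma analytic_at_sub F G z :
  analytic_at F z -> analytic_at G z -> analytic_at (fun w => F w - G w) z.
Proof.
move=> [u [r [r0 Fu]]] [v [s [s0 Gv]]].
have [m [m0 mr ms]] := exists_min_gt0 r0 s0.
exists (fun n => u n - v n), m; split => // w wm.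
by apply: cvg_powserB; [apply: Fu | apply: Gv]; exact: lt_le_trans wm _.
Qed.

Lemma analytic_at_conj F z :
  analytic_at F z^* -> analytic_at (fun w => (F w^*)^*) z.
Proof.
move=> [u [r [r0 Fu]]]; exists (fun n => (u n)^*), r; split => // w wr.
have wr' : `|w^* - z^*| < r by rewrite -rmorphB norm_conjC.
rewrite (_ : series _ =
  (fun x : C => x^*) \o series (fun n => u n * (w^* - z^*) ^+ n)).
  apply: cvg_comp; first exact: Fu wr'.
  exact: continuous_conj.
apply/funext => n; rewrite /series /= rmorph_sum.
by apply: eq_bigr => k _; rewrite rmorphM rmorphXn rmorphB /= !conjCK.
Qed.

Lemma analytic_at_eq0_near F z : analytic_at F z ->
  (forall e, 0 < e -> exists w, `|w - z| < e /\ \forall x \near w, F x = 0) ->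
  \forall x \near z, F x = 0.
Proof.
move=> [u [r [r0 Fu]]] acc; apply: contrapT => nz.
have F0 : forall w, `|w| < r -> F (z + w) = 0.
  apply: (@powser_isolated_zero _ u) => // [w wr|e e0].
    by have := Fu (z + w); rewrite addrAC subrr add0r; apply.
  have [w [we Fw]] := acc _ e0; exists (w - z); split.
  (* If [w] were [z] itself, [F] would already vanish near [z]. *)
  - by rewrite subr_eq0; apply/eqP => wz; apply: nz; rewrite -wz.
  - exact: we.
  - by rewrite addrC subrK; exact: nbhs_singleton Fw.
apply: nz; apply: filterS (near_dist_lt z r0) => x zx.
by rewrite -(subrK z x) addrC; apply: F0; rewrite distrC.
Qed.

Lemma continuous_ofR_scale (z : C) : continuous (fun s : R => ofR s * z : C).
Proof.
move=> s; apply/(@cvgrPdist_lt _ _ _ (nbhs s) (nbhs_filter s)) => e e0.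
(* The added 1 keeps the divisor positive when [z = 0]. *)
have n0 : 0 < `|z| + 1 by rewrite ltr_wpDl.
have [d d0 ed] := gt0_ofR (divr_gt0 e0 n0).
have sd := nbhsx_ballx s d d0.
apply: filterS sd => x; rewrite -ball_normE /= => sx.
rewrite -mulrBl -ofRB normrM norm_ofR.
apply: le_lt_trans (_ : ofR `|s - x| * (`|z| + 1) < _).
  by rewrite ler_wpM2l ?lerDl // -ofR0 ofR_le.
by rewrite -ltr_pdivlMr // ed ofR_lt.
Qed.

(** Connectedness of [[0, 1]]: the parameters near whose image [F] vanishes identically form a
    nonempty, relatively open and relatively closed subset. *)
Lemma star_shaped_identity F z :
  (forall s : R, 0 <= s <= 1 -> analytic_at F (ofR s * z)) ->
  (\forall x \near 0, F x = 0) -> F z = 0.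
Proof.
move=> anF F0.
pose A := [set s : R | 0 <= s <= 1 /\ \forall x \near ofR s * z, F x = 0].
suff : A = `[0, 1]%classic.
  move=> /(congr1 (fun B => B 1)) /= AE.
  have [_ /nbhs_singleton] : A 1 by rewrite AE in_itv /= ler01 lexx.
  by rewrite /ofR /= mul1r.
pose U := [set w : C | \forall x \near w, F x = 0].
have Uo : open U.
  by rewrite openE => w; exact: (@nbhs_interior _ w [set x | F x = 0]).
have ofRc := @continuous_ofR_scale z.
apply: segment_connected.
- by exists 0; split; [rewrite lexx ler01 | rewrite /ofR /= mul0r].
- exists ((fun s => ofR s * z) @^-1` U).
    by apply: open_comp => // s _; exact: ofRc.
  by apply/seteqP; split => s /=; rewrite in_itv.
(* Closedness: a point of the segment in the closure of [U] is a limit of points near which [F]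
   vanishes, so [analytic_at_eq0_near] puts it in [U]. *)
- exists ((fun s => ofR s * z) @^-1` (closure U)).
    apply: closed_comp; last exact: closed_closure.
    by move=> s _; exact: ofRc.
  apply/seteqP; split => s /=; rewrite in_itv.
    by move=> [s01 Fs]; split => //; exact: subset_closure.
  move=> [s01 clU]; split; first exact: s01.
  apply: analytic_at_eq0_near; first exact: anF.
  move=> e e0; have [w [Uw bw]] := clU _ (nbhsx_ballx (ofR s * z) e e0).
  by exists w; split; [move: bw; rewrite -ball_normE /= distrC | exact: Uw].
Qed.

End Analytic.

(** * Conjugation symmetry of the hypergeometric function *)

Section HypergeometricConjugation.
Variable R : realType.
Local Notation C := (Cplx R).
Implicit Types (F G : C -> C) (z w : C).

Lemma slit_plane_conj z : slit_plane z -> slit_plane z^*.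
Proof.
rewrite /slit_plane /= Im_conj Re_conj => sz [/eqP]; rewrite oppr_eq0.
by move=> /eqP iz rz; apply: sz.
Qed.

Lemma pochhammer_conj (a : C) n : (pochhammer a n)^* = pochhammer a^* n.
Proof.
rewrite /pochhammer rmorph_prod; apply: eq_bigr => k _.
by rewrite rmorphD /= conjC_nat.
Qed.

Lemma hyp2F1_term_conj (a b c z : C) n :
  (hyp2F1_term a b c z n)^* = hyp2F1_term a^* b^* c^* z^* n.
Proof.
rewrite /hyp2F1_term !(rmorphM, fmorphV, rmorphXn) /=.
by rewrite !pochhammer_conj conjC_nat.
Qed.

Lemma is_hyp2F1_conj (a b c : C) F :
  a^* = a -> b^* = b -> c^* = c ->
  is_hyp2F1 a b c F -> is_hyp2F1 a b c (fun z => (F z^*)^*).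
Proof.
move=> ar br cr [anF serF]; split=> [z sz|z z1].
  by apply: analytic_at_conj; apply: anF; exact: slit_plane_conj.
have z1' : `|z^*| < 1 by rewrite norm_conjC.
rewrite (_ : series _ = (fun x : C => x^*) \o series (hyp2F1_term a b c z^*)).
  apply: cvg_comp; first exact: serF z1'.
  exact: continuous_conj.
apply/funext => n; rewrite /series /= rmorph_sum; apply: eq_bigr => k _.
by rewrite /= hyp2F1_term_conj conjCK ar br cr.
Qed.

Lemma slit_plane_scale (s : R) z : 0 <= s <= 1 -> slit_plane z ->
  slit_plane (ofR s * z).
Proof.
move=> /andP[s0 s1] sz [/eqP +].
rewrite ImMl ?ReMl ?ofR_real // mulf_eq0 => /orP[/eqP ->|/eqP iz sz1].
  by rewrite mul0r ler10.
move: sz sz1; rewrite /slit_plane /= iz.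
have /complex_realP[a ->] := Creal_Re z.
rewrite -[(a%:C)%C]/(ofR a) -ofRM -ofR1 !ofR_le => sz sa1.
apply: sz; split; first exact: erefl.
by have [a0|a0] := leP 0 a; nra.
Qed.

Lemma is_hyp2F1_unique (a b c : C) F G z :
  is_hyp2F1 a b c F -> is_hyp2F1 a b c G -> slit_plane z -> F z = G z.
Proof.
move=> [anF serF] [anG serG] sz; apply/eqP; rewrite -subr_eq0; apply/eqP.
apply: (@star_shaped_identity _ (fun w => F w - G w)) => [s s01|].
  by apply: analytic_at_sub; [apply: anF|apply: anG]; exact: slit_plane_scale.
apply: filterS (near_dist_lt 0 ltr01) => w; rewrite sub0r normrN => w1.
apply/eqP; rewrite subr_eq0; apply/eqP.
have /cvg_unique := serF _ w1; apply; first exact: norm_hausdorff.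
exact: serG.
Qed.

Lemma hyp2F1_conj (a b c z : C) : a^* = a -> b^* = b -> c^* = c ->
  slit_plane z -> hyp2F1 a b c z^* = (hyp2F1 a b c z)^*.
Proof.
move=> ar br cr sz; rewrite /hyp2F1.
(* Without a continuation, [hyp2F1] is the constant 0, which is its own conjugate. *)
case: pselect => [exF|_]; last by rewrite conjC0.
case: (cid exF) => F hF /=; apply: (canRL conjCK).
by apply: (is_hyp2F1_unique (is_hyp2F1_conj ar br cr hF) hF sz).
Qed.

End HypergeometricConjugation.

(** * The inversion [tau |-> -1/tau] and its effect on the values of [pi_t] *)

Section Involution.
Variable R : realType.
Local Notation C := (Cplx R).
Implicit Types (z tau : C) (w : sphere R) (t : R).

Lemma upper_nonreal z : 'Im z != 0 -> slit_plane z.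
Proof. by move=> /eqP iz [] /iz. Qed.

(** Passing from [z] to [1 - z] swaps the two hypergeometric factors, and inverting ['i] supplies
    the sign. With [0^-1 = 0] the identity survives a vanishing denominator. *)
Lemma f_t_conj1sub t z : 'Im z != 0 ->
  f_t t (1 - z^*) = refl_line 0 (- (f_t t z)^-1).
Proof.
move=> iz; rewrite /f_t /refl_line mul0rn sub0r rmorphN opprK.
have rt : (ofR t)^* = ofR t := conj_ofR t.
have rt1 : (1 - ofR t)^* = 1 - ofR t by rewrite rmorphB /= conjC1 rt.
have iz1 : 'Im (1 - z) != 0.
  by rewrite raddfB /= (Creal_ImP 1 _) ?real1 // sub0r oppr_eq0.
have -> : 1 - z^* = (1 - z)^* by rewrite rmorphB /= conjC1.
rewrite (hyp2F1_conj rt rt1 (conjC1 _) (upper_nonreal iz1)).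
have -> : 1 - (1 - z)^* = z^* by rewrite rmorphB /= conjC1 subKr.
rewrite (hyp2F1_conj rt rt1 (conjC1 _) (upper_nonreal iz)).
by rewrite !(invfM, invrK, fmorphV, rmorphM) /= conjCi invrN invCi opprK; ring.
Qed.

Lemma sphere_conjK : involutive (@sphere_conj R).
Proof. by case=> [z|] //=; rewrite conjCK. Qed.

Lemma sphere_1subK : involutive (@sphere_1sub R).
Proof. by case=> [z|] //=; rewrite subKr. Qed.

Lemma sphere_conj_1sub w :
  sphere_conj (sphere_1sub w) = sphere_1sub (sphere_conj w).
Proof. by case: w => [z|] //=; rewrite rmorphB /= conjC1. Qed.

Lemma Im_inv_gt0 tau : (0 < 'Im (- tau^-1)) = (0 < 'Im tau).
Proof.
have [->|t0] := eqVneq tau 0; first by rewrite invr0 oppr0.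
rewrite raddfN /= ImV mulNr opprK pmulr_lgt0 //.
by rewrite invr_gt0 exprn_gt0 // normr_gt0.
Qed.

Lemma Im_refl_line (c tau : C) : c \is Num.real ->
  'Im (refl_line c tau) = 'Im tau.
Proof.
move=> cr; rewrite /refl_line raddfB /= Im_conj opprK.
by rewrite (Creal_ImP _ _) ?add0r // rpredMn.
Qed.

Lemma Im_refl_circle (c r tau : C) : c \is Num.real -> r \is Num.real ->
  0 < 'Im (refl_circle c r tau) -> 0 < 'Im tau.
Proof.
move=> cr rr; rewrite /refl_circle raddfD /= (Creal_ImP _ cr) add0r.
rewrite ImMl ?rpredX // ImV raddfB /= Im_conj (Creal_ImP _ cr) subr0 opprK.
have r20 : 0 <= r ^+ 2 by rewrite -realEsqr.
have [->|r2] := eqVneq (r ^+ 2) 0; first by rewrite mul0r ltxx.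
have r2_gt0 : 0 < r ^+ 2 by rewrite lt_def r2.
rewrite pmulr_rgt0 //.
(* At the pole the reflection takes the real value [c], contradicting the positive imaginary
   part. *)
have [->|n0] := eqVneq (tau^* - c) 0.
  by rewrite normr0 expr0n invr0 mulr0 ltxx.
by rewrite pmulr_lgt0 // invr_gt0 exprn_gt0 // normr_gt0.
Qed.

Lemma refl_line0K tau : refl_line 0 (refl_line 0 tau) = tau.
Proof. by rewrite /refl_line mul0rn !sub0r rmorphN opprK /= conjCK. Qed.

Lemma Im_1sub_conj z : 'Im (1 - z^*) = 'Im z.
Proof. by rewrite raddfB /= Im_conj opprK (Creal_ImP 1 _) ?real1 // add0r. Qed.

(** The map [x |-> 1 - conj x] is an involutive homeomorphism of the plane, so it extends
    continuously to the sphere, infinity included. *)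
Lemma cvg_sphere_1sub_conj (z : nat -> C) w :
  (fun n => Some (z n) : sphere R) @ \oo --> w ->
  (fun n => Some (1 - (z n)^*) : sphere R) @ \oo -->
    sphere_1sub (sphere_conj w).
Proof.
pose g x : C := 1 - x^*.
have gK : cancel g g by move=> x; rewrite /g rmorphB /= conjC1 conjCK subKr.
have gc : continuous g.
  move=> x; apply: (@cvgB _ _ _ (nbhs x)); first exact: cvg_cst.
  exact: continuous_conj.
move=> zw; rewrite (_ : sphere_1sub _ = omap g w); last by case: (w).
apply: (cvg_comp (fun n => Some (z n)) (omap g) zw).
exact: (continuous_omap_homeomorphism gK gK gc gc).
Qed.

Lemma cvg_refl_line0_inv (u : nat -> C) tau : tau != 0 ->
  u @ \oo --> tau ->
  (fun n => refl_line 0 (- (u n)^-1)) @ \oo --> refl_line 0 (- tau^-1).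
Proof.
move=> t0 ut; apply: cvgB; first exact: cvg_cst.
apply: (@cvg_comp _ _ _ _ (fun x : C => x^*)); last exact: continuous_conj.
by apply: cvgN; exact: cvgV.
Qed.

Lemma Im_gt0_neq0 tau : 0 < 'Im tau -> tau != 0.
Proof.
move=> tau0; apply: contraTneq tau0 => ->.
by rewrite (Creal_ImP 0 _) ?real0 // ltxx.
Qed.

Lemma conj_sub_real_neq0 tau (x : C) : 0 < 'Im tau -> x \is Num.real ->
  tau^* - x != 0.
Proof.
move=> tau0 xr; apply: contraTneq tau0 => /eqP; rewrite subr_eq0 => /eqP tx.
by rewrite -oppr_lt0 -Im_conj tx (Creal_ImP _ xr) ltxx.
Qed.

(* Restricted to the upper half-plane because at the poles of the reflections
   the junk value 0^-1 = 0 breaks the identities between them. *)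
Lemma pi_rel_inversion t tau w : lambda_t t != 0 -> 0 < 'Im tau ->
  pi_rel t tau w -> pi_rel t (- tau^-1) (sphere_1sub w).
Proof.
set l := lambda_t t => l0 + rel.
have lr : l \is Num.real by exact: ofR_real.
have l2 : l / 2 *+ 2 = l by rewrite -mulr_natr divfK // pnatr_eq0.
elim: rel => {tau w}
  [z z0 _|z tau w z0 zw ft _ tau0|tau w _ IH|tau w _ IH|tau w _ IH].
- have -> : sphere_1sub (Some z) = sphere_conj (Some (1 - z^*)).
    by rewrite /= rmorphB /= conjC1 conjCK.
  rewrite -[- _]refl_line0K -f_t_conj1sub ?gt_eqF //.
  by apply: pi_rel_side01; apply: pi_rel_inv; rewrite Im_1sub_conj.
- rewrite -[- _]refl_line0K -[sphere_1sub w]sphere_conjK sphere_conj_1sub.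
  apply: pi_rel_side01.
  apply: (@pi_rel_boundary _ _ (fun n => 1 - (z n)^*)).
  + by move=> n; rewrite Im_1sub_conj.
  + exact: cvg_sphere_1sub_conj.
  + rewrite (_ : (fun n => _) = (fun n => refl_line 0 (- (f_t t (z n))^-1))).
      by apply: cvg_refl_line0_inv ft; exact: Im_gt0_neq0.
    by apply/funext => n; rewrite f_t_conj1sub // gt_eqF.
  + by rewrite Im_refl_line ?real0 // Im_inv_gt0.
- rewrite Im_refl_line ?real0 // => tau0; rewrite -sphere_conj_1sub.
  rewrite (_ : - _ = refl_line 0 (- tau^-1)).
    exact/pi_rel_side01/IH.
  by rewrite /refl_line mul0rn !sub0r invrN rmorphN fmorphV.
- rewrite Im_refl_line ?rpred_div ?realn // => tau0; rewrite -sphere_conj_1sub.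
  (* Inversion sends the line [Re = l / 2] to the circle of centre [-1/l] and radius [1/l], the
     mirror image of the third side in [Re = 0]. Three reflections replace one; two of the three
     conjugations on the value cancel. *)
  have := pi_rel_side01 (pi_rel_side1 (pi_rel_side01 (IH tau0))).
  rewrite sphere_conjK; congr (pi_rel _ _ _).
  rewrite /refl_line /refl_circle l2 -/l !mul0rn !sub0r.
  rewrite !(rmorphN, fmorphV, rmorphD, rmorphB, rmorphM, rmorphXn) /=.
  rewrite ?(conj_Creal lr) ?conjCK.
  have s0 : tau^* != 0.
    by have := conj_sub_real_neq0 tau0 (@real0 C); rewrite subr0.
  have sl : l - tau^* != 0 by rewrite -oppr_eq0 opprB conj_sub_real_neq0.
  move: (tau^*) s0 sl => s s0 sl; clearbody l; field.
  by rewrite sl l0 s0.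
- move=> tau0.
  (* The induction hypothesis concerns [tau], so positivity is pulled back through the circle
     reflection. *)
  have {}tau0 : 0 < 'Im tau by apply: Im_refl_circle tau0; rewrite rpredV.
  rewrite -sphere_conj_1sub.
  have := pi_rel_side01 (pi_rel_side0 (pi_rel_side01 (IH tau0))).
  rewrite sphere_conjK; congr (pi_rel _ _ _).
  rewrite /refl_line /refl_circle l2 -/l !mul0rn !sub0r.
  rewrite !(rmorphN, fmorphV, rmorphD, rmorphB, rmorphM, rmorphXn) /=.
  rewrite ?(conj_Creal lr) ?conjCK.
  have s0 : tau^* != 0.
    by have := conj_sub_real_neq0 tau0 (@real0 C); rewrite subr0.
  have sl : tau^* * l - 1 != 0.
    have := conj_sub_real_neq0 tau0 (rpredVr lr).
    apply: contraNneq => /eqP; rewrite subr_eq0 => /eqP sl1.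
    by rewrite subr_eq0 -(mulfK l0 tau^*) sl1 div1r.
  move: (tau^*) s0 sl => s s0 sl; clearbody l; field.
  by rewrite subrK mulf_neq0 // l0 sl s0.
Qed.

Lemma pi_t_inversion t tau : lambda_t t != 0 -> 0 < 'Im tau ->
  pi_t t (- tau^-1) = sphere_1sub (pi_t t tau).
Proof.
move=> l0 tau0.
have rel w : pi_rel t (- tau^-1) w <-> pi_rel t tau (sphere_1sub w).
  have tau0' : 0 < 'Im (- tau^-1) by rewrite Im_inv_gt0.
  split=> h; last by have := pi_rel_inversion l0 tau0 h; rewrite sphere_1subK.
  by have := pi_rel_inversion l0 tau0' h; rewrite invrN invrK opprK.
(* If neither point has a unique value, both sides are the default [None], which [sphere_1sub]
   fixes. *)
rewrite /pi_t; case: pselect => [ex1|nex1]; case: pselect => [ex2|nex2] //.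
- case: (cid ex1) => w1 [w1P w1U] /=; case: (cid ex2) => w2 [w2P w2U] /=.
  by rewrite (w2U _ ((rel _).1 w1P)) sphere_1subK.
- case: nex2; case: ex1 => w [wP wU]; exists (sphere_1sub w).
  split; first exact: (rel _).1.
  move=> w' w'P; rewrite (wU (sphere_1sub w')) ?sphere_1subK //.
  by apply/rel; rewrite sphere_1subK.
- case: nex1; case: ex2 => w [wP wU]; exists (sphere_1sub w).
  split; first by apply/rel; rewrite sphere_1subK.
  by move=> w' /rel /wU ->; rewrite sphere_1subK.
Qed.

(** The angle [(1 - 2t) pi / 2] lies strictly between [-pi/2] and [pi/2], where the cosine is
    positive. *)
Lemma lambda_t_neq0 t : 0 < t < 1 -> lambda_t t != 0.
Proof.
move=> /andP[t0 t1]; rewrite /lambda_t gt_eqF // -ofR0 ofR_lt mulr_gt0 //.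
have := pi_gt0 R => pi0.
by apply: cos_gt0_pihalf; apply/andP; split; nra.
Qed.

Lemma modular_solution_1sub t p (alpha beta : sphere R) :
  lambda_t t != 0 -> (0 < p)%N -> modular_solution t p alpha beta ->
  modular_solution t p (sphere_1sub beta) (sphere_1sub alpha).
Proof.
move=> l0 p0 [tau [tau0 -> ->]].
have pn0 : p%:R != 0 :> C by rewrite pnatr_eq0 -lt0n.
have ptau0 : 0 < 'Im (p%:R * tau).
  by rewrite ImMl ?realn // mulr_gt0 // ltr0n.
exists (- (p%:R * tau)^-1); split.
- by rewrite Im_inv_gt0.
- by rewrite pi_t_inversion.
- by rewrite -pi_t_inversion // mulrN invfM mulVKf.
Qed.

End Involution.

Theorem theorem2p3 (R : realType) (t : R) (p : nat)
    (P : {poly {poly Cplx R}}) :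
  t \in [:: 2^-1; 3^-1; 4^-1] ->
  (1 < p)%N ->
  irreducible_elt P ->
  size P = sizeY P ->
  (forall alpha beta : sphere R,
     modular_solution t p alpha beta -> sphere_eval P alpha beta = 0) ->
  forall alpha beta : sphere R,
    modular_solution t p alpha beta ->
    sphere_eval P alpha beta = 0 ->
    modular_solution t p (sphere_1sub beta) (sphere_1sub alpha) /\
    sphere_eval P (sphere_1sub beta) (sphere_1sub alpha) = 0.
Proof.
move=> tP p1 _ _ Psol alpha beta sol _.
have t01 : 0 < t < 1.
  by move: tP; rewrite !inE => /or3P[] /eqP ->; apply/andP; split; lra.
have sol' := modular_solution_1sub (lambda_t_neq0 t01) (ltnW p1) sol.
by split; [exact: sol' | exact: Psol sol'].
Qed.
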